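(* Let $M\{z,w\}$ and $L\{z,w\}$ be the moment and cumulant generating functions associated with a state $\widehat{\phi}$ on $\mathcal{B}$. Then, in the algebra $\mathcal{A}(S)$, $$L\{z,w\}=L\{z,0\}+\bigl(M_{\star}\{z,w\}-M\{z,0\}\bigr)M_{\star}^{-1}\{z,w\},$$ where $M_\star\{z,w\}=f_{\star g}$ with $f=M\{z,w\}$ and $g=M^{-1}\{z,0\}$, and $M_\star^{-1}\{z,w\}$ is the inverse of $M_\star\{z,w\}$ in $\mathcal{A}(S)$.
   Context: Words and admissible partitions. $S=FS(\{z,w\})$ is the free semigroup of all finite words in $z,w$ including the empty word $1$; $S^{+}=S\setminus\{1\}$; $S(z)=\{z^n:n\ge0\}$, $S(w)=\{w^n:n\ge0\}$; $l(s)$ is the length of $s$. A subword of $s=s_1\ldots s_n$ is a subsequence $s_{i_1}\ldots s_{i_k}$, $1\le i_1<\ldots<i_k\le n$, with its indices remembered (when a function on $S$ is evaluated at a subword, the subword is regarded simply as a word). A partition of $s\in S^+$ is a sequence $u=(u_1,\ldots,u_p)$ of nonempty subwords with pairwise disjoint index sets whose union is $\{1,\ldots,n\}$, ordered by increasing first index. A letter $s_j$ not belonging to $u_l=s_{i_1}\ldots s_{i_k}$ is inner with respect to $u_l$ if $i_1<j<i_k$. The partition $u$ is admissible if no letter equal to $w$ is inner with respect to any word $u_l$ of $u$ to which it does not belong. $\mathcal{AP}(s)$ is the set of admissible partitions of $s$. Moments and cumulants. $\mathcal{B}=\mathbf{C}\langle X,X',P\rangle$ is the unital *-algebra of polynomials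 in noncommuting self-adjoint $X,X'$ and a projection $P$; $X(z)=X$, $X(w)=X'$. For a state $\widehat\phi$ on $\mathcal{B}$: $M(s)=\widehat{\phi}(X(s_1)\cdots X(s_n))$ for $s=s_1\ldots s_n\in S^+$, $M(1)=1$; the admissible cumulants $(L(s))_{s\in S^+}$ are defined recursively by $M(s)=\sum_{p=1}^{l(s)}\sum_{u=(u_1,\ldots,u_p)\in\mathcal{AP}(s)}L(u_1)\cdots L(u_p)$, $s\in S^+$. Semigroup algebra. $\mathcal{A}(S)$ is the algebra of all functions $f:S\to\mathbf{C}$, written as formal sums $\sum_{s\in S}f(s)s$, with pointwise addition and product $(fg)(s)=\sum_{uv=s}f(u)g(v)$; its unit is the indicator of the empty word. An element with $f(1)=1$ is invertible in $\mathcal{A}(S)$. $\mathcal{A}(S(z))$ is defined analogously (formal power series in $z$). Generating functions. $M\{z,w\}=\sum_{s\in S}\frac{M(s)}{n(s)!}s$ and $L\{z,w\}=\sum_{s\in S^+}\frac{L(s)}{n(s)!}s$, where $n(s)!=n_1!n_2!\cdots n_p!$ for $s=z^{n_1}w^{k_1}z^{n_2}w^{k_2}\cdots w^{k_{p-1}}z^{n_p}$ with $n_1,n_p\ge0$ and all other exponents $\ge1$. $M\{z,0\}$, $L\{z,0\}$ denote the restrictions of $M\{z,w\}$, $L\{z,w\}$ to the support $S(z)$. $M^{-1}\{z,0\}$ is the inverse of $M\{z,0\}$. Operation $f_{\star g}$. For $f\in\mathcal{A}(S)$, $g\in\mathcal{A}(S(z))$, $f_{\star g}\in\mathcal{A}(S)$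 agrees with $f$ on $S(z)$, and on $S\setminus S(z)$ is given by $$f_{\star g}(z_1w_1z_2w_2\ldots z_{p-1}w_{p-1}z_p)=\sum_{u_1v_1=z_1}\cdots\sum_{u_{p-1}v_{p-1}=z_{p-1}}f(u_1w_1u_2w_2\ldots u_{p-1}w_{p-1}z_p)\,g(v_1)\cdots g(v_{p-1})$$ for $w_1,\ldots,w_{p-1}\in S(w)\setminus\{1\}$, $z_1,z_p\in S(z)$, $z_2,\ldots,z_{p-1}\in S(z)\setminus\{1\}$, $p\ge2$ (here $u_i,v_i$ range over all elements of $S(z)$, including $1$, with $u_iv_i=z_i$). *)

(* Defs.v *)
From HB Require Import structures.
From mathcomp Require Import all_boot all_order all_algebra.
From mathcomp Require Import boolp functions reals.
From mathcomp Require Import complex finmap.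
From mathcomp Require Import multinomials.monalg.

Set Implicit Arguments.
Unset Strict Implicit.
Unset Printing Implicit Defensive.

Import Order.TTheory GRing.Theory Num.Theory.
Local Open Scope ring_scope.

Variant gen := gX | gX' | gP.

Definition nat_of_gen g : nat := match g with gX => 0 | gX' => 1 | gP => 2 end.
Definition gen_of_nat n := match n with 0 => gX | 1 => gX' | _ => gP end%N.
Lemma nat_of_genK : cancel nat_of_gen gen_of_nat. Proof. by case. Qed.
HB.instance Definition _ := Countable.copy gen (can_type nat_of_genK).

(* The relations P ^+ 2 = P and star P = P are built in the basis: B is the
   algebra of the monoid of words in X, X', P without two adjacent P's, where
   concatenation is followed by the replacement of PP by P. *)
Definition noPP (x y : gen) := (x != gP) || (y != gP).

Definition push (x : gen) (s : seq gen) :=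
  if s is y :: _ then if noPP x y then x :: s else s else [:: x].

Definition red (s : seq gen) : seq gen := foldr push [::] s.

Lemma push_sorted x s : sorted noPP s -> sorted noPP (push x s).
Proof. by case: s => //= y s; case: ifP => //= ->. Qed.

Lemma red_sorted s : sorted noPP (red s).
Proof. by elim: s => //= x s; apply: push_sorted. Qed.

Lemma red_id s : sorted noPP s -> red s = s.
Proof.
elim: s => //= x [|y s] //= IH /andP[xy ys].
by move: (IH ys); rewrite /= => -> /=; rewrite xy.
Qed.

Lemma push_idem x y s : ~~ noPP x y -> push x (push y s) = push y s.
Proof.
rewrite /noPP negb_or !negbK => /andP[/eqP-> /eqP->].
by case: s => [|[] s].
Qed.

Lemma red_catr u v : red (u ++ red v) = red (u ++ v).
Proof. by elim: u => /= [|x u ->] //; rewrite red_id ?red_sorted. Qed.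

Lemma red_catl u v : red (red u ++ v) = red (u ++ v).
Proof.
elim: u => //= x u <-; case: (red u) => [|y s] //=.
by case: ifP => [|/negbT] //= /push_idem ->.
Qed.

Lemma red_eq0 s : red s = [::] -> s = [::].
Proof. by case: s => //= x s; rewrite /push; case: (red s) => // y t; case: ifP. Qed.

Lemma noPPC x y : noPP x y = noPP y x.
Proof. by rewrite /noPP orbC. Qed.

Lemma rev_noPP s : sorted noPP (rev s) = sorted noPP s.
Proof. by rewrite rev_sorted; apply: eq_sorted => x y; apply: noPPC. Qed.

Lemma red_rev s : red (rev s) = rev (red s).
Proof.
elim: s => // x s IH; rewrite rev_cons -cats1 -red_catl IH /=.
have sr := red_sorted s.
case E: (red s) sr => [|y t] // sr; rewrite /push.
case: ifP => [xy|/negbT xy].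
  by rewrite cats1 -rev_cons red_id // rev_noPP /= xy.
rewrite rev_cons -cats1 -catA /= -red_catr.
move: xy; rewrite /noPP negb_or !negbK => /andP[/eqP-> /eqP ey].
rewrite ey in sr *; rewrite /= cats1 -rev_cons red_id //.
by rewrite rev_noPP.
Qed.

Record bmonom : predArgType :=
  BMonom { bmonom_val :> seq gen; _ : sorted noPP bmonom_val }.
HB.instance Definition _ := [isSub for bmonom_val].
HB.instance Definition _ := [Choice of bmonom by <:].

Definition mkb (s : seq gen) : bmonom := BMonom (red_sorted s).

Definition bone : bmonom := mkb [::].
Definition bmul (u v : bmonom) : bmonom := mkb (u ++ v).

Lemma bmonomP (u : bmonom) : sorted noPP u. Proof. exact: (valP u). Qed.

Lemma bmulA : associative bmul.
Proof. by move=> u v t; apply: val_inj; rewrite /= red_catl red_catr catA. Qed.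
Lemma bmul1m : left_id bone bmul.
Proof. by move=> u; apply: val_inj; rewrite /= red_id ?bmonomP. Qed.
Lemma bmulm1 : right_id bone bmul.
Proof. by move=> u; apply: val_inj; rewrite /= cats0 red_id ?bmonomP. Qed.
Lemma bmul_eq1 u v : bmul u v = bone -> u = bone /\ v = bone.
Proof.
move=> /(congr1 val) /= /red_eq0 uv; split; apply: val_inj => /=.
  by case: (val u) uv.
by case: (val u) uv.
Qed.

HB.instance Definition _ :=
  Choice_isMonomialDef.Build bmonom bmulA bmul1m bmulm1 bmul_eq1.

Notation calB R := {malg (R : realType)[i] [bmonom]}.

Definition genB (R : realType) (g : gen) : calB R := << mkb [:: g] >>.

Definition brev (u : bmonom) : bmonom := mkb (rev u).

Definition starB (R : realType) (b : calB R) : calB R :=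
  \sum_(k <- msupp b) << (b@_k)^* *g brev k >>.

Lemma brevK : involutive brev.
Proof.
move=> u; apply: val_inj => /=.
by rewrite red_rev (red_id (red_sorted _)) -red_rev revK red_id ?bmonomP.
Qed.

Lemma brevM u v : brev (bmul u v) = bmul (brev v) (brev u).
Proof.
apply: val_inj => /=; rewrite red_catl red_catr -rev_cat !red_rev.
by rewrite (red_id (red_sorted _)).
Qed.

Section StarTheory.
Variable R : realType.
Implicit Types (a b : calB R) (c : R[i]) (k : bmonom).

Lemma starB_coef b k : (starB b)@_k = (b@_(brev k))^*.
Proof.
rewrite /starB raddf_sum /=.
under eq_bigr do rewrite mcoeffU -(inj_eq (can_inj brevK)) brevK.
have [kb|kb] := boolP (brev k \in msupp b).
  rewrite (big_fsetD1 (brev k)) //= eqxx mulr1n big1_fset ?addr0 // => i.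
  by rewrite in_fsetD1 => /andP[/negbTE-> _] _; rewrite mulr0n.
rewrite (mcoeff_outdom kb) rmorph0 big1_fset // => i ib _.
by case: eqP ib kb => [->->|]; rewrite ?mulr0n.
Qed.

Lemma starBD a b : starB (a + b) = starB a + starB b.
Proof. by apply/malgP => k; rewrite !(starB_coef, mcoeffD) rmorphD. Qed.

Lemma starBZ c b : starB (c *: b) = c^* *: starB b.
Proof. by apply/malgP => k; rewrite !(starB_coef, mcoeffZ) rmorphM. Qed.

Lemma starBK : involutive (@starB R).
Proof. by move=> b; apply/malgP => k; rewrite !starB_coef brevK conjCK. Qed.

Lemma starBU c k : starB << c *g k >> = << c^* *g brev k >> :> calB R.
Proof.
apply/malgP => i; rewrite starB_coef !mcoeffU -(inj_eq (can_inj brevK)) brevK.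
by rewrite rmorphMn.
Qed.

Lemma starB_sum (I : Type) (r : seq I) (F : I -> calB R) :
  starB (\sum_(i <- r) F i) = \sum_(i <- r) starB (F i).
Proof.
apply: (big_morph _ starBD); apply/malgP => k.
by rewrite starB_coef !mcoeff0 rmorph0.
Qed.

Lemma starBM a b : starB (a * b) = starB b * starB a.
Proof.
rewrite (monalgE a) (monalgE b) mulr_suml !starB_sum mulr_sumr.
apply: eq_bigr => k _; rewrite mulr_sumr mulr_suml starB_sum.
apply: eq_bigr => j _.
by rewrite !starBU /GRing.mul /= !fgmulUU starBU brevM rmorphM mulrC.
Qed.

Lemma starB_gen g : starB (genB R g) = genB R g.
Proof.
by rewrite /genB starBU rmorph1; congr mkmalgU; apply: val_inj; case: g.
Qed.

Lemma genBP_idem : genB R gP * genB R gP = genB R gP.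
Proof.
rewrite /genB /GRing.mul /= fgmulUU mulr1; congr mkmalgU.
exact: val_inj.
Qed.

End StarTheory.

Definition is_state (R : realType) (phi : {scalar calB R}) : Prop :=
  phi 1 = 1 /\ forall b : calB R, 0 <= phi (starB b * b).

Variant letter := Lz | Lw.

Definition isz a := if a is Lz then true else false.
Definition letter_of_bool (b : bool) := if b then Lz else Lw.
Lemma iszK : cancel isz letter_of_bool. Proof. by case. Qed.
HB.instance Definition _ := Equality.copy letter (can_type iszK).

Definition word := seq letter.

(* The word z^n_1 w^k_1 ... z^n_(p-1) w^k_(p-1) z^m is represented by
   bs = [:: (n_1, k_1); ..; (n_(p-1), k_(p-1))] and m; the representation is
   unique when all k_i > 0 and n_i > 0 for i >= 2. *)
Fixpoint of_blocks (bs : seq (nat * nat)) (m : nat) : word :=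
  if bs is (n, k) :: bs' then nseq n Lz ++ nseq k Lw ++ of_blocks bs' m
  else nseq m Lz.

Definition canonical_blocks (bs : seq (nat * nat)) :=
  all (fun b => 0 < b.2)%N bs && all (fun b => 0 < b.1)%N (behead bs).

Fixpoint blocks (s : word) : seq (nat * nat) * nat :=
  match s with
  | [::] => ([::], 0)
  | Lz :: s' => let: (bs, m) := blocks s' in
      if bs is (n, k) :: bs' then ((n.+1, k) :: bs', m) else ([::], m.+1)
  | Lw :: s' => let: (bs, m) := blocks s' in
      if bs is (0, k) :: bs' then ((0, k.+1) :: bs', m) else ((0, 1) :: bs, m)
  end%N.

Lemma blocksK s : of_blocks (blocks s).1 (blocks s).2 = s.
Proof.
elim: s => //= -[] s; case: (blocks s) => [[|[n k] bs] m] /= IH.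
- by rewrite IH.
- by rewrite IH.
- by rewrite IH.
by case: n IH => [|n] /= ->.
Qed.

Lemma blocks_canonical s : canonical_blocks (blocks s).1.
Proof.
elim: s => //= -[] s; case: (blocks s) => [[|[n k] bs] m] //=.
by case: n => [|n]; rewrite /canonical_blocks /= => /andP[/andP[kp ->] ->]; rewrite ?kp.
Qed.

Lemma of_blocksK bs m : canonical_blocks bs -> blocks (of_blocks bs m) = (bs, m).
Proof.
elim: bs => [_|[n k] bs IH].
  by elim: m => //= m ->.
case/andP=> /= /andP[k0 kbs] nbs.
have {IH} E : blocks (of_blocks bs m) = (bs, m).
  by apply: IH; rewrite /canonical_blocks kbs; case: (bs) nbs => //= b l /andP[].
have {k0 E} : blocks (nseq k Lw ++ of_blocks bs m) = ((0, k) :: bs, m)%N.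
  case: k k0 => // k _; elim: k => [|k IHk].
    by rewrite /= E; case: bs nbs {kbs E} => [|[[|a] b] bs].
  by move: IHk; rewrite [nseq k.+2 _]/= cat_cons /= => ->.
by move=> E; elim: n => //= n ->.
Qed.

Definition wfact (s : word) : nat :=
  ((\prod_(b <- (blocks s).1) b.1`!) * (blocks s).2`!)%N.

(* A subword of s with its indices remembered is a set of positions of s. *)
Section Partitions.
Variable s : word.
Notation I := 'I_(size s).

Definition subword (A : {set I}) : word :=
  [seq tnth (in_tuple s) i | i <- enum A].

Definition inner (A : {set I}) (j : I) : bool :=
  (j \notin A) && [exists i in A, exists k in A, (i < j < k)%N].

(* Blocks of a partition being canonically ordered by their first index,
   partitions of s are encoded as set partitions of its positions. *)
Definition admissible (u : {set {set I}}) : bool :=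
  partition u [set: I] &&
  [forall A in u, forall j, (tnth (in_tuple s) j == Lw) ==> ~~ inner A j].

End Partitions.

Definition admissible_cumulants (C : pzRingType) (M L : word -> C) : Prop :=
  forall s : word, s != [::] ->
    M s = \sum_(u : {set {set 'I_(size s)}} | admissible u)
            \prod_(A in u) L (subword A).

Section CumulantsExist.
Variable C : pzRingType.
Implicit Types M L : word -> C.

Lemma size_subword s (A : {set 'I_(size s)}) : size (subword A) = #|A|.
Proof. by rewrite size_map cardE. Qed.

Lemma subword_setT s : subword [set: 'I_(size s)] = s.
Proof.
rewrite /subword (eq_enum (B := predT)) => [|i]; last by rewrite inE.
by rewrite -[RHS](map_tnth_enum (in_tuple s)).
Qed.

Lemma admissible_setT s : s != [::] -> admissible [set [set: 'I_(size s)]].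
Proof.
move=> s0; apply/andP; split.
  rewrite /partition /cover big_set1 eqxx /trivIset /cover !big_set1 eqxx /=.
  by rewrite inE eq_sym -card_gt0 cardsT card_ord lt0n size_eq0.
apply/forall_inP => A; rewrite inE => /eqP->; apply/forallP => j.
by rewrite /inner inE implybT.
Qed.

Lemma admissible_lt s (u : {set {set 'I_(size s)}}) A :
  admissible u -> u != [set [set: 'I_(size s)]] -> A \in u ->
  (size (subword A) < size s)%N.
Proof.
case/andP=> /and3P[_ /trivIsetP tu u0] _ uT Au.
rewrite size_subword -[X in (_ < X)%N](card_ord (size s)) -cardsT.
apply: proper_card; rewrite properT; apply: contra uT => /eqP AT.
rewrite eqEsubset sub1set -AT Au andbT; apply/subsetP => B Bu; rewrite inE.
apply: contraT => BA; have := tu A B Au Bu; rewrite eq_sym BA => /(_ isT).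
rewrite AT -setI_eq0 setTI => /eqP B0; by rewrite -B0 Bu in u0.
Qed.

Lemma cumulant_sum L s : s != [::] ->
  \sum_(u : {set {set 'I_(size s)}} | admissible u) \prod_(A in u) L (subword A)
  = L s + \sum_(u : {set {set 'I_(size s)}}
                | admissible u && (u != [set [set: 'I_(size s)]]))
            \prod_(A in u) L (subword A).
Proof.
by move=> s0; rewrite (bigD1 _ (admissible_setT s0)) big_set1 subword_setT.
Qed.

Fixpoint cum_rec n M s : C :=
  if n is n'.+1 then
    M s - \sum_(u : {set {set 'I_(size s)}}
                | admissible u && (u != [set [set: 'I_(size s)]]))
            \prod_(A in u) cum_rec n' M (subword A)
  else 0.

Lemma admissible_cumulants_exist M : exists L, admissible_cumulants M L.
Proof.
pose L s := cum_rec (size s).+1 M s; exists L => s s0; rewrite cumulant_sum //.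
have E : forall m k s, (size s < m)%N -> (size s < k)%N ->
    cum_rec m M s = cum_rec k M s.
  elim=> [|m IH] [|k] // t tm tk /=; congr (_ - _); apply: eq_bigr => u.
  case/andP=> au uT; apply: eq_bigr => A Au.
  have tA := admissible_lt au uT Au.
  by apply: IH; [exact: leq_trans tA tm | exact: leq_trans tA tk].
rewrite {1}/L [X in X + _]/=; set x := (X in M s - X + _); set y := (X in _ + X).
suff -> : x = y by rewrite addrNK.
apply: eq_bigr => u /andP[au uT]; apply: eq_bigr => A Au.
by apply: E => //; apply: admissible_lt Au.
Qed.

Lemma admissible_cumulants_unique M L L' :
  admissible_cumulants M L -> admissible_cumulants M L' ->
  forall s, s != [::] -> L s = L' s.
Proof.
move=> HL HL' s; have [n] := ubnP (size s); elim: n s => // n IH s sn s0.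
have := HL s s0; rewrite (HL' s s0) !cumulant_sum //.
set x := (X in _ + X = _); set y := (X in _ = _ + X).
suff -> : x = y by move/addIr.
apply: eq_bigr => u /andP[au uT]; apply: eq_bigr => A Au; symmetry; apply: IH.
  exact: leq_trans (admissible_lt au uT Au) _.
case/andP: au => /and3P[_ _ u0] _; rewrite -size_eq0 size_subword cards_eq0.
by apply: contraNneq u0 => <-.
Qed.

End CumulantsExist.

Definition wseries (K : Type) := word -> K.

Section WSeries.
Variable K : fieldType.
HB.instance Definition _ := GRing.Zmodule.copy (wseries K) (word -> K).
Implicit Types (f g h : wseries K) (s : word).

Definition ws1 : wseries K := fun s => (s == [::])%:R.

(* The factorizations s = u v are indexed by the length of u. *)
Definition wsmul f g : wseries K :=
  fun s => \sum_(i < (size s).+1) f (take i s) * g (drop i s).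

Let D a f : wseries K := fun s => f (a :: s).

Lemma wsmul0 f g : wsmul f g [::] = f [::] * g [::].
Proof. by rewrite /wsmul big_ord1. Qed.

Lemma wsmulS f g a s :
  wsmul f g (a :: s) = f [::] * g (a :: s) + wsmul (D a f) g s.
Proof. by rewrite /wsmul big_ord_recl. Qed.

Lemma wsmulDl : left_distributive wsmul +%R.
Proof.
move=> f g h; apply/funext => s; rewrite /wsmul [RHS]/GRing.add /= -big_split /=.
by apply: eq_bigr => i _; rewrite -mulrDl.
Qed.

Lemma wsmulDr : right_distributive wsmul +%R.
Proof.
move=> f g h; apply/funext => s; rewrite /wsmul [RHS]/GRing.add /= -big_split /=.
by apply: eq_bigr => i _; rewrite -mulrDr.
Qed.

Lemma wsmulZl c f g s : wsmul (fun t => c * f t) g s = c * wsmul f g s.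
Proof. by rewrite /wsmul mulr_sumr; apply: eq_bigr => i _; rewrite mulrA. Qed.

Lemma wsmulA : associative wsmul.
Proof.
move=> f g h; apply/funext => s; elim: s f g => [|a s IH] f g.
  by rewrite !wsmul0 mulrA.
rewrite !wsmulS wsmul0 IH mulrDr mulrA -addrA; congr (_ + _).
have -> : D a (wsmul f g) = (fun t => f [::] * D a g t) + wsmul (D a f) g :> wseries K.
  by apply/funext => t; rewrite /D wsmulS.
by rewrite wsmulDl /GRing.add /= wsmulZl.
Qed.

Lemma wsmul1r : left_id ws1 wsmul.
Proof.
move=> f; apply/funext => -[|a s]; first by rewrite wsmul0 mul1r.
by rewrite wsmulS mul1r /wsmul big1 ?addr0 // => i _; rewrite mul0r.
Qed.

Lemma wsmulr1 : right_id ws1 wsmul.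
Proof.
move=> f; apply/funext => s; elim: s f => [|a s IH] f.
  by rewrite wsmul0 mulr1.
by rewrite wsmulS mulr0 add0r IH.
Qed.

Lemma ws1_neq0 : ws1 != 0.
Proof.
apply/eqP => /(congr1 (fun f : wseries K => f [::])) /eqP.
by rewrite /ws1 oner_eq0.
Qed.

HB.instance Definition _ := GRing.Zmodule_isNzRing.Build (wseries K)
  wsmulA wsmul1r wsmulr1 wsmulDl wsmulDr ws1_neq0.

Fixpoint wsinv_rec n f s : K :=
  if n is n'.+1 then
    if s is a :: s' then
      - (f [::])^-1 *
        \sum_(i < (size s').+1) f (a :: take i s') * wsinv_rec n' f (drop i s')
    else (f [::])^-1
  else 0.

Definition ws_unit : pred (wseries K) := fun f => f [::] != 0.
Definition ws_inv f : wseries K :=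
  if ws_unit f then fun s => wsinv_rec (size s).+1 f s else f.

Lemma wsinv_recE n f s : (size s < n)%N ->
  wsinv_rec n f s = wsinv_rec (size s).+1 f s.
Proof.
suff H : forall m k s, (size s < m)%N -> (size s < k)%N ->
    wsinv_rec m f s = wsinv_rec k f s.
  by move=> sn; apply: H.
elim=> [|m IH] [|k] //= [|a t] //= tm tk; congr (_ * _).
apply: eq_bigr => i _; congr (_ * _); apply: IH; rewrite size_drop;
  exact: leq_ltn_trans (leq_subr _ _) _.
Qed.

Lemma ws_inv0 f : ws_unit f -> ws_inv f [::] = (f [::])^-1.
Proof. by rewrite /ws_inv => ->. Qed.

Lemma ws_invS f a s : ws_unit f ->
  ws_inv f (a :: s) = - (f [::])^-1 * wsmul (D a f) (ws_inv f) s.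
Proof.
move=> uf; rewrite /wsmul /ws_inv uf.
have -> n : wsinv_rec n.+1 f (a :: s) = - (f [::])^-1 *
    \sum_(i < (size s).+1) f (a :: take i s) * wsinv_rec n f (drop i s) by [].
congr (_ * _); apply: eq_bigr => i _.
by congr (_ * _); apply: wsinv_recE; rewrite ltnS size_drop leq_subr.
Qed.

Lemma ws_mulrV f : ws_unit f -> f * ws_inv f = 1.
Proof.
move=> uf; apply/funext => -[|a s]; rewrite [LHS]/GRing.mul /=.
  by rewrite wsmul0 ws_inv0 ?divff.
by rewrite wsmulS ws_invS // mulrA mulrN divff // mulN1r addNr.
Qed.

Lemma ws_mulVr : {in ws_unit, left_inverse 1 ws_inv *%R}.
Proof.
move=> f uf; have fV := ws_mulrV uf.
have uV : ws_unit (ws_inv f) by rewrite /ws_unit ws_inv0 ?invr_neq0.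
have VV := ws_mulrV uV.
suff E : f = ws_inv (ws_inv f) by rewrite {2}E.
by rewrite -[LHS]mulr1 -VV mulrA fV mul1r.
Qed.

Lemma ws_mulrV_in : {in ws_unit, right_inverse 1 ws_inv *%R}.
Proof. by move=> f; apply: ws_mulrV. Qed.

Lemma ws_unitP f g : g * f = 1 /\ f * g = 1 -> ws_unit f.
Proof.
case=> /(congr1 (fun h : wseries K => h [::])) + _.
rewrite /GRing.mul /= wsmul0 => gf; apply/eqP => f0.
by move/eqP: gf; rewrite f0 mulr0 eq_sym oner_eq0.
Qed.

Lemma ws_inv_out : {in [predC ws_unit], ws_inv =1 id}.
Proof. by move=> f /negbTE uf; rewrite /ws_inv; have -> : ws_unit f = false by []. Qed.

HB.instance Definition _ := GRing.NzRing_hasMulInverse.Build (wseries K)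
  ws_mulVr ws_mulrV_in ws_unitP ws_inv_out.

Lemma wseries_unitE f : (f \is a GRing.unit) = (f [::] != 0).
Proof. by []. Qed.

(* A(S(z)) is the subalgebra of A(S) of the functions supported in S(z). *)
Definition inSz : pred word := all isz.

Definition restr_z f : wseries K := fun s => if inSz s then f s else 0.

Definition supp_z f := forall s, ~~ inSz s -> f s = 0.

Lemma supp_restr_z f : supp_z (restr_z f).
Proof. by move=> s /negbTE; rewrite /restr_z => ->. Qed.

Lemma supp_z_inv f : f \is a GRing.unit -> supp_z f -> supp_z f^-1.
Proof.
rewrite wseries_unitE => uf zf s; rewrite [f^-1]/GRing.inv /=.
have [n] := ubnP (size s); elim: n s => // n IH [|a s] //= sn zs.
rewrite ws_invS // /wsmul big1 ?mulr0 // => i _.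
have [zd|zd] := boolP (inSz (drop i s)); last first.
  by rewrite IH ?mulr0 // size_drop (leq_ltn_trans (leq_subr _ _)).
rewrite /D zf ?mul0r //; apply: contra zs => /= /andP[-> zt].
by rewrite -(cat_take_drop i s) /inSz /= all_cat; apply/andP.
Qed.

(* For the word with blocks bs and last exponent m: each z^n_i is split as
   u_i v_i = z^a z^(n_i - a). *)
Fixpoint fstar_rec g (bs : seq (nat * nat)) (m : nat) f : K :=
  if bs is (n, k) :: bs' then
    \sum_(a < n.+1)
      fstar_rec g bs' m (fun t => f (nseq a Lz ++ nseq k Lw ++ t))
        * g (nseq (n - a) Lz)
  else f (nseq m Lz).

Definition fstar f g : wseries K :=
  fun s => fstar_rec g (blocks s).1 (blocks s).2 f.

Lemma fstar_blocks f g bs m : canonical_blocks bs ->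
  fstar f g (of_blocks bs m) = fstar_rec g bs m f.
Proof. by move=> cbs; rewrite /fstar of_blocksK. Qed.

Lemma fstar_z f g n : fstar f g (nseq n Lz) = f (nseq n Lz).
Proof. exact: (@fstar_blocks f g [::] n). Qed.

Definition mgf (M : word -> K) : wseries K := fun s => M s / (wfact s)%:R.

Definition cgf (L : word -> K) : wseries K :=
  fun s => if s is [::] then 0 else L s / (wfact s)%:R.

End WSeries.

Definition gen_of_letter (a : letter) : gen := if a is Lz then gX else gX'.

(* The empty product gives M(1) = phi 1, which is 1 for a state. *)
Definition moment (R : realType) (phi : {scalar calB R}) : word -> R[i] :=
  fun s => phi (\prod_(a <- s) genB R (gen_of_letter a)).

(* Main.v *)
(** In an admissible partition the letters w of a block are consecutive among all
    the w's of the word.  Summing over the block V that contains the first w, what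
    is left of V splits at the w's of V into independent words, so the moments
    satisfy M - m = m L1 M, where m is the part of M supported on S(z) and L1 is the
    part of L off S(z) with each inner run of z's convolved with m: the factors m
    account for the z's enclosed by V but partitioned among themselves.  Dividing by
    n(s)! turns the choice of the z's of V in each run into these convolutions.
    Since m^-1 is convolved with every run but the last, the operation star removes
    all those factors and leaves M* - m = (L - L{z,0}) M*. *)
Require Import Defs.
From HB Require Import structures.
From mathcomp Require Import all_boot all_order all_algebra.
From mathcomp Require Import reals complex.
From mathcomp Require Import multinomials.monalg.
Local Open Scope ring_scope.
From mathcomp Require Import boolp zify ring.

Set Implicit Arguments.
Unset Strict Implicit.
Unset Printing Implicit Defensive.
Import GRing.Theory.

(** * Sums over set partitions with multiplicative weights *)

Section SetPartitionSums.
Variable C : comNzRingType.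

Definition psum (T : finType) (f : {set T} -> C) (D : {set T}) : C :=
  \sum_(u : {set {set T}} | partition u D) \prod_(A in u) f A.

Lemma eq_psum (T : finType) (f g : {set T} -> C) (D : {set T}) :
  (forall A : {set T}, A != set0 -> A \subset D -> f A = g A) ->
  psum f D = psum g D.
Proof.
move=> fg; apply: eq_bigr => u uD; apply: eq_bigr => A Au.
by apply: fg; [apply: partition_neq0 uD Au | apply: partitionS uD Au].
Qed.

Lemma psum0 (T : finType) (f : {set T} -> C) : psum f set0 = 1.
Proof.
rewrite /psum (big_pred1 set0) ?big_set0 // => u; exact: partition_set0.
Qed.

(** The block [A] through [x] is chosen first; deleting it leaves an arbitrary partition of the
    rest. *)
Lemma psum_peel (T : finType) (f : {set T} -> C) (x : T) (D : {set T}) :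
  x \in D ->
  psum f D = \sum_(A : {set T} | (x \in A) && (A \subset D))
               f A * psum f (D :\: A).
Proof.
move=> xD.
have px u : partition u D -> x \in cover u by move/cover_partition ->.
rewrite /psum (partition_big (fun u => pblock u x)
  (fun A => (x \in A) && (A \subset D))) /=; last first.
  move=> u uD; rewrite mem_pblock px //=.
  by apply: partitionS (uD) _; rewrite pblock_mem ?px.
apply: eq_bigr => A /andP[xA AD]; rewrite mulr_sumr.
(* [A] contains [x] and no block of [v] does, so adding and deleting [A] are mutually inverse. *)
have nAv v : partition v (D :\: A) -> A \notin v.
  move=> vDA; apply/negP => /(partitionS vDA)/subsetP/(_ x xA).
  by rewrite inE xA.
rewrite (reindex_onto (fun v => A |: v) (fun u => u :\ A)) /=; last first.
  move=> u /andP[uD /eqP pA]; rewrite setD1K // -pA pblock_mem //; exact: px.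
apply: eq_big => [v|v /andP[/andP[uD _] /eqP vA]]; last first.
  by rewrite big_setU1 // -vA setD11.
apply/idP/idP => [/andP[/andP[uD /eqP pA] /eqP <-]|vDA].
  by apply: partitionD1 => //; rewrite setU11.
have uD : partition (A |: v) D.
  rewrite -(setID D A) (setIidPr AD); apply: partitionU1 => //.
    by apply/set0Pn; exists x.
  by rewrite -setI_eq0 setIC setIDAC setDIl setDv ?setI0 // setIC set0I.
rewrite uD (def_pblock (partition_trivIset uD) _ xA) ?setU11 // eqxx.
by rewrite (setU1K (nAv v vDA)) eqxx.
Qed.

(** Partitions with a block meeting both parts weigh 0, and the others are pairs of partitions. The
    induction peels off the block of a point of [D1]. *)
Lemma psum_split (T : finType) (f : {set T} -> C) (D1 D2 : {set T}) :
  [disjoint D1 & D2] ->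
  (forall A : {set T}, A \subset D1 :|: D2 ->
     A :&: D1 != set0 -> A :&: D2 != set0 -> f A = 0) ->
  psum f (D1 :|: D2) = psum f D1 * psum f D2.
Proof.
have [n] := ubnP #|D1|; elim: n D1 => // n IH D1 D1n dD f0.
have [->|/set0Pn[x xD1]] := eqVneq D1 set0.
  by rewrite set0U psum0 mul1r.
rewrite (@psum_peel _ f x) ?inE ?xD1 // (psum_peel _ xD1) mulr_suml.
rewrite (bigID (fun A : {set T} => A \subset D1)) /= [X in _ + X]big1 ?addr0.
  apply: eq_big => [A|A /andP[/andP[xA _] AD]].
    rewrite -andbA; congr (_ && _); apply/idP/idP => [/andP[]//|AD].
    by rewrite AD (subset_trans AD) ?subsetUl.
  have dA : [disjoint A & D2] by apply: disjointWl dD.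
  have -> : (D1 :|: D2) :\: A = (D1 :\: A) :|: D2.
    rewrite setDUl; congr (_ :|: _); apply/setDidPl.
    by rewrite disjoint_sym.
  rewrite IH ?mulrA //.
  - apply: leq_trans (proper_card _) (D1n); apply/properP; split.
      exact: subsetDl.
    by exists x => //; rewrite inE xA.
  - by apply: disjointWl dD; apply: subsetDl.
  move=> B BD /set0Pn[y]; rewrite !inE => /and3P[yB _ yD] B2; apply: f0 => //.
    by apply: subset_trans BD _; rewrite setSU ?subsetDl.
  by apply/set0Pn; exists y; rewrite inE yB.
move=> A /andP[/andP[xA sAD] /subsetPn[y yA yD]]; rewrite f0 ?mul0r //.
  by apply/set0Pn; exists x; rewrite inE xA.
apply/set0Pn; exists y; rewrite inE yA.
by have := subsetP sAD y yA; rewrite inE (negbTE yD).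
Qed.

(** Induction by peeling needs only the transport of single blocks along [h], not of whole
    partitions. *)
Lemma psum_imset (T T' : finType) (h : T' -> T) (f : {set T} -> C)
    (D : {set T'}) :
  injective h -> psum f (h @: D) = psum (fun A => f (h @: A)) D.
Proof.
move=> hI; have [n] := ubnP #|D|; elim: n D => // n IH D Dn.
have [->|/set0Pn[x xD]] := eqVneq D set0; first by rewrite imset0 !psum0.
rewrite (@psum_peel _ f (h x)) ?imset_f // (psum_peel _ xD).
rewrite (reindex_onto (fun A : {set T'} => h @: A)
  (fun A : {set T} => h @^-1: A)) /=; last first.
  move=> A /andP[_ /subsetP AD]; apply/setP => y; apply/imsetP/idP.
    by case=> z; rewrite inE => zA ->.
  by move=> yA; have /imsetP[z _ yz] := AD y yA; exists z; rewrite // inE -yz.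
apply: eq_big => [A|A].
  rewrite mem_imset //; have -> : (h @: A \subset h @: D) = (A \subset D).
    apply/idP/idP => [/subsetP AD|]; last exact: imsetS.
    by apply/subsetP => z zA; rewrite -(mem_imset D z hI) AD ?imset_f.
  rewrite andb_idr // => _; apply/eqP/setP => z.
  by rewrite inE mem_imset.
rewrite mem_imset // => /andP[/andP[xA _] _].
congr (_ * _); have -> : h @: D :\: h @: A = h @: (D :\: A).
  apply/setP => y; apply/setDP/imsetP => [[/imsetP[z zD ->]]|[z + ->]].
    by rewrite mem_imset // => zA; exists z; rewrite // inE zA.
  by rewrite inE !mem_imset // => /andP[].
apply: IH; apply: leq_trans (proper_card _) (Dn); apply/properP.
by split; [apply: subsetDl | exists x; rewrite // inE xA].
Qed.

End SetPartitionSums.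

(** * Admissibility block by block, and restriction to subwords *)

Section AdmissibleBlocks.
Variable C : comNzRingType.
Implicit Types (M L : word -> C) (s t : word).

Definition good s (A : {set 'I_(size s)}) : bool :=
  [forall j, (tnth (in_tuple s) j == Lw) ==> ~~ inner A j].

Lemma goodP s (A : {set 'I_(size s)}) :
  reflect (forall i j k : 'I_(size s), i \in A -> k \in A -> (i < j < k)%N ->
             tnth (in_tuple s) j = Lw -> j \in A) (good A).
Proof.
apply: (iffP forallP) => [gA i j k iA kA ijk /eqP jw|gA j].
  have /implyP/(_ jw) := gA j; rewrite negb_and negbK => /orP[//|].
  by move/existsP; case; exists i; rewrite iA; apply/existsP; exists k; rewrite kA.
apply/implyP => /eqP jw; apply/negP => /andP[/negP jA].
by move=> /exists_inP[i iA /exists_inP[k kA ijk]]; apply/jA/(gA i j k).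
Qed.

Lemma sorted_enum_set n (A : {set 'I_n}) : sorted (relpre val ltn) (enum A).
Proof.
rewrite [enum _]/enum_mem -enumT; apply: sorted_filter.
  by move=> i j k /=; apply: ltn_trans.
by rewrite -sorted_map val_enum_ord iota_ltn_sorted.
Qed.

Lemma enum_set_eq n (A : {set 'I_n}) (e : seq 'I_n) :
  sorted (relpre val ltn) e -> A =i e -> enum A = e.
Proof.
move=> se Ae; apply: (irr_sorted_eq (leT := relpre val ltn)) => //.
- by move=> i j k /=; apply: ltn_trans.
- by move=> i /=; apply: ltnn.
- exact: sorted_enum_set.
- by move=> i; rewrite mem_enum Ae.
Qed.

Lemma subword0 s : subword (set0 : {set 'I_(size s)}) = [::].
Proof. by rewrite /subword enum_set0. Qed.

Lemma subword1 s (i : 'I_(size s)) : subword [set i] = [:: tnth (in_tuple s) i].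
Proof. by rewrite /subword enum_set1. Qed.

Lemma subword_cat s (A B : {set 'I_(size s)}) :
  (forall i j : 'I_(size s), i \in A -> j \in B -> (i < j)%N) ->
  subword (A :|: B) = subword A ++ subword B.
Proof.
move=> AB; rewrite /subword -map_cat; congr map; apply: enum_set_eq; last first.
  by move=> i; rewrite mem_cat !mem_enum inE.
have tr : transitive (relpre (val : 'I_(size s) -> nat) ltn).
  by move=> i j k /=; apply: ltn_trans.
rewrite sorted_pairwise // pairwise_cat -!sorted_pairwise // !sorted_enum_set.
by rewrite !andbT; apply/allrelP => i j; rewrite !mem_enum; apply: AB.
Qed.

(** Admissibility constrains each block separately, so giving bad blocks weight 0 replaces
    admissible partitions by all partitions. *)
Definition block_weight L s (A : {set 'I_(size s)}) : C :=
  if good A then L (subword A) else 0.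

Lemma admissible_psum L s :
  \sum_(u : {set {set 'I_(size s)}} | admissible u) \prod_(A in u) L (subword A)
  = psum (block_weight L (s := s)) setT.
Proof.
rewrite /psum (bigID (fun u : {set {set 'I_(size s)}} =>
  [forall A in u, good A]) (fun u => partition u _)) /= [X in _ + X]big1.
  rewrite addr0; apply: eq_bigr => u /andP[_ /forall_inP gu].
  by apply: eq_bigr => A /gu gA; rewrite /block_weight ifT.
move=> u /andP[_ /forall_inPn[A Au gA]].
by rewrite (bigD1 A) //= /block_weight; rewrite ifN ?mul0r.
Qed.

Lemma moment_psum M L s : M [::] = 1 -> admissible_cumulants M L ->
  M s = psum (block_weight L (s := s)) setT.
Proof.
move=> M1 ML; have [->|s0] := eqVneq s [::]; last by rewrite -admissible_psum ML.
rewrite M1 (_ : setT = set0) ?psum0 //; apply/setP; by case.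
Qed.

(** A w of [s] between two letters of [D] belongs to [D], so a block inside [D] has the same inner
    w's in [s] as in the word [subword D]. *)
Lemma psum_good M L s (D : {set 'I_(size s)}) :
  M [::] = 1 -> admissible_cumulants M L -> good D ->
  psum (block_weight L (s := s)) D = M (subword D).
Proof.
move=> M1 ML /goodP gD; rewrite (moment_psum _ M1 ML).
(* The increasing enumeration of [D], from positions of the subword to positions of [s]. *)
pose h (k : 'I_(size (subword D))) : 'I_(size s) :=
  enum_val (cast_ord (size_subword D) k).
have hI : injective h by move=> i j /enum_val_inj /cast_ord_inj.
have hD : h @: setT = D.
  apply/setP => y; apply/imsetP/idP => [[k _ ->]|yD]; first exact: enum_valP.
  exists (cast_ord (esym (size_subword D)) (enum_rank_in yD y)) => //.
  by rewrite /h cast_ordKV enum_rankK_in.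
have h_lt (i j : 'I_(size (subword D))) : (i < j)%N -> (h i < h j)%N.
  move=> ij; have x0 := h i.
  have li (k : 'I_(size (subword D))) : (k < size (enum D))%N.
    by rewrite -cardE -(size_subword D).
  rewrite /h !(enum_val_nth x0) /=.
  apply: (sorted_ltn_nth (leT := relpre val ltn) _ x0 (sorted_enum_set D)) => //.
    by move=> ? ? ? /=; apply: ltn_trans.
  by rewrite inE; apply: li. by rewrite inE; apply: li.
have h_ltE i j : (h i < h j)%N = (i < j)%N.
  apply/idP/idP; last exact: h_lt.
  apply: contraTT; rewrite -!leqNgt leq_eqVlt => /orP[/eqP/val_inj->//|/h_lt].
  exact: ltnW.
have hE k : tnth (in_tuple (subword D)) k = tnth (in_tuple s) (h k).
  have x0 := h k.
  rewrite (tnth_nth Lz) /= /subword (nth_map x0) -?cardE ?(enum_val_nth x0) //.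
    by rewrite /h (enum_val_nth x0).
  by rewrite -(size_subword D).
rewrite -{1}hD psum_imset //; apply: eq_psum => B _ _.
rewrite /block_weight; congr (if _ then L _ else _).
  apply/goodP/goodP => gB i j k.
    move=> iB kB ijk jw; rewrite -(mem_imset B j hI); apply: (gB (h i) _ (h k)).
    - exact: imset_f.
    - exact: imset_f.
    - by rewrite !h_ltE.
    - by rewrite -hE.
  move=> /imsetP[i' iB ->] /imsetP[k' kB ->] ijk jw.
  (* Goodness of [D] is used here: the w at [j] lies in the range of [h]. *)
  have /imsetP[j' _ jj] : j \in h @: setT.
    by rewrite hD; apply: gD ijk jw; apply: enum_valP.
  rewrite jj in ijk jw *.
  apply: imset_f; apply: (gB i' _ k') => //; last by rewrite hE.
  by rewrite !h_ltE in ijk.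
rewrite /subword (enum_set_eq (e := map h (enum B))).
- by rewrite -map_comp; apply: eq_map => k /=; rewrite hE.
- rewrite sorted_map; apply: sub_sorted (sorted_enum_set B) => i j /=.
  exact: h_lt.
- move=> i; apply/imsetP/mapP => [[k kB ->]|[k]]; rewrite ?mem_enum => *.
    by exists k; rewrite ?mem_enum.
  by exists k.
Qed.

End AdmissibleBlocks.

(** * Selecting the block of the first w by reading the word *)

Lemma sum_subsetU1 (V : zmodType) (T : finType) (x : T) (F : {set T})
    (h : {set T} -> V) : x \notin F ->
  \sum_(A : {set T} | A \subset x |: F) h A =
  \sum_(A : {set T} | A \subset F) (h A + h (x |: A)).
Proof.
move=> xF; rewrite big_split /= (bigID (fun A : {set T} => x \notin A)) /=.
congr (_ + _).
  apply: eq_bigl => A; apply/andP/idP => [[/subsetP AF xA]|AF].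
    apply/subsetP => y yA; have := AF y yA; rewrite !inE.
    by case: eqP yA xA => [->->|].
  split; first exact: subset_trans AF (subsetUr _ _).
  by apply: contra xF; apply/subsetP.
rewrite (reindex_onto (fun A => x |: A) (fun A => A :\ x)) /=; last first.
  by move=> A /andP[_]; rewrite negbK; apply: setD1K.
apply: eq_bigl => A; rewrite negbK setU11 andbT; apply/andP/idP => [[AF /eqP <-]|AF].
  by rewrite subDset.
split; first exact: setUS.
by rewrite setU1K //; apply: contra xF; apply/subsetP.
Qed.

Section LetterScan.
Variable C : comNzRingType.
Implicit Types (M L l : word -> C) (s t v : word).

(* The weighted sum over the ways to select letters of [t] up to a first rejected
   w: [l] is the weight of the selected subword as a function of the part still
   to be read, and [c] counts the z's rejected since the last selected w. *)
Fixpoint scan M l (c : nat) t : C :=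
  match t with
  | [::] => l [::] * M (nseq c Lz)
  | Lz :: t' => scan M (fun v => l (Lz :: v)) c t' + scan M l c.+1 t'
  | Lw :: t' => M (nseq c Lz) * scan M (fun v => l (Lw :: v)) 0 t'
                + l [::] * M (nseq c Lz ++ t)
  end.

(** This is what [good] becomes for a set containing the first w of [s]: nothing is selected after a
    rejected w. *)
Definition w_initial s (A : {set 'I_(size s)}) : bool :=
  [forall j, (tnth (in_tuple s) j == Lw) && (j \notin A) ==>
    [forall i in A, i < j]%N].

Lemma w_initialP s (A : {set 'I_(size s)}) :
  reflect (forall i j : 'I_(size s), tnth (in_tuple s) j = Lw -> j \notin A ->
             i \in A -> (i < j)%N) (w_initial A).
Proof.
apply: (iffP forallP) => [wA i j /eqP jw jA iA|wA j].
  by have := wA j; rewrite jw jA => /forall_inP; apply.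
by apply/implyP => /andP[/eqP jw jA]; apply/forall_inP => i; apply: wA.
Qed.

Lemma subword_from s k :
  subword [set i : 'I_(size s) | (k <= i)%N] = drop k s.
Proof.
have [m] := ubnP (size s - k); elim: m k => // m IH k km.
have [ks|ks] := leqP (size s) k.
  rewrite drop_oversize // (_ : [set _ | _] = set0) ?subword0 //.
  apply/setP => i; rewrite !inE; apply/negbTE; rewrite -ltnNge.
  exact: leq_trans ks.
have -> : [set i : 'I_(size s) | (k <= i)%N]
    = [set Ordinal ks] :|: [set i : 'I_(size s) | (k < i)%N].
  by apply/setP => i; rewrite !inE -val_eqE /= leq_eqVlt eq_sym.
rewrite subword_cat => [|i j]; last by rewrite !inE => /eqP ->.
rewrite subword1 IH; last lia.
by rewrite (tnth_nth Lz) /= -drop_nth.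
Qed.

Lemma subword_nseq s (A : {set 'I_(size s)}) :
  (forall i, i \in A -> tnth (in_tuple s) i = Lz) -> subword A = nseq #|A| Lz.
Proof.
move=> Az; rewrite cardE /subword.
have : {subset enum A <= A} by move=> i; rewrite mem_enum.
elim: (enum A) => //= i e IH eA; rewrite Az ?IH //.
  by move=> j je; apply: eA; rewrite inE je orbT.
by apply: eA; rewrite inE eqxx.
Qed.

(* [P] and [Z] are the choices already made at the positions before [k]: [P] is
   selected, [Z] collects the rejected z's since the last w of [P].  Rejecting a w
   ends the selection, and selecting one separates [Z] from the later letters. *)
Lemma sum_w_initial M L l s k (P Z : {set 'I_(size s)}) :
  M [::] = 1 -> admissible_cumulants M L -> (k <= size s)%N ->
  (forall i, i \in P -> (i < k)%N) -> (forall i, i \in Z -> (i < k)%N) ->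
  (forall j : 'I_(size s), (j < k)%N -> tnth (in_tuple s) j = Lw -> j \in P) ->
  (forall i j : 'I_(size s), i \in Z -> (i <= j < k)%N ->
    tnth (in_tuple s) j = Lz) ->
  \sum_(A : {set 'I_(size s)} | A \subset [set i : 'I_(size s) | (k <= i)%N])
     (if w_initial (P :|: A) then l (subword (P :|: A)) *
        psum (block_weight L (s := s))
          (Z :|: ([set i : 'I_(size s) | (k <= i)%N] :\: A)) else 0)
  = scan M (fun v => l (subword P ++ v)) #|Z| (drop k s).
Proof.
move=> M1 ML; have [m] := ubnP (size s - k).
elim: m k P Z => // m IH k P Z km ks Pk Zk wP zZ.
have Zz i : i \in Z -> tnth (in_tuple s) i = Lz.
  by move=> iZ; apply: (zZ i _ iZ); rewrite leqnn Zk.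
have Z_w (i j : 'I_(size s)) :
    i \in Z -> (i <= j)%N -> tnth (in_tuple s) j = Lw -> (k <= j)%N.
  move=> iZ ij jw; rewrite leqNgt; apply/negP => jk.
  by have := zZ i j iZ; rewrite ij jk jw => /(_ isT).
have [sk|sk] := leqP (size s) k.
  have -> : [set i : 'I_(size s) | (k <= i)%N] = set0.
    apply/setP => i; rewrite !inE; apply/negbTE; rewrite -ltnNge.
    exact: leq_trans sk.
  rewrite (big_pred1 set0) => [|A]; last by rewrite subset0.
  rewrite setU0 setD0 setU0 drop_oversize //= cats0 ifT.
    rewrite (psum_good M1 ML) ?(subword_nseq Zz) //.
    apply/goodP => i j i' iZ _ /andP[ij _] jw.
    by have := Z_w i j iZ (ltnW ij) jw; rewrite leqNgt (leq_trans _ sk).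
  apply/w_initialP => i j jw /negP[]; apply: wP => //.
  exact: leq_trans sk.
(* [K] is the position read at this step; the sets [A] are split by whether they contain it. *)
pose K := Ordinal sk; pose F := [set i : 'I_(size s) | (k < i)%N].
have FE : [set i : 'I_(size s) | (k <= i)%N] = K |: F.
  by apply/setP => i; rewrite !inE -val_eqE /= leq_eqVlt eq_sym.
have KF : K \notin F by rewrite inE /= ltnn.
have KP : K \notin P by apply/negP => /Pk /=; rewrite ltnn.
have ksD (A : {set 'I_(size s)}) : A \subset F -> (K |: F) :\: A = K |: (F :\: A).
  move=> /subsetP AF; apply/setP => i; rewrite !inE; case: eqP => [->|] //=.
  by rewrite andbT; apply: contra KF; apply: AF.
have ksD1 (A : {set 'I_(size s)}) : (K |: F) :\: (K |: A) = F :\: A.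
  apply/setP => i; rewrite !inE; case: eqP => [->|] //=.
  by rewrite ltnn andbF.
have P1k : forall i, i \in K |: P -> (i < k.+1)%N.
  by move=> i; rewrite !inE => /orP[/eqP->//|/Pk]; apply: ltnW.
have sP1 : subword (K |: P) = rcons (subword P) (tnth (in_tuple s) K).
  rewrite setUC subword_cat ?subword1 ?cats1 // => i j /Pk ik.
  by rewrite inE => /eqP->.
rewrite FE sum_subsetU1 // (drop_nth Lz) //.
rewrite -[nth _ _ _](tnth_nth Lz (in_tuple s) K).
have lE a : tnth (in_tuple s) K = a ->
    (fun v => l (subword P ++ a :: v)) = (fun v => l (subword (K |: P) ++ v)).
  by move=> E; apply/funext => v; rewrite sP1 cat_rcons E.
have PKA (A : {set 'I_(size s)}) : P :|: (K |: A) = K |: P :|: A.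
  by rewrite setUCA setUA.
rewrite big_split /=.
case E: (tnth (in_tuple s) K).
  rewrite addrC; congr (_ + _).
    under eq_bigr do rewrite ksD1 PKA.
    rewrite (lE _ E); apply: (IH k.+1) => //.
    - lia.
    - by move=> i /Zk; apply: ltnW.
    - move=> j; rewrite ltnS leq_eqVlt !inE => /orP[/eqP jk|jk] jw.
        by rewrite -val_eqE /= jk eqxx.
      by rewrite wP ?orbT.
    - move=> i j iZ; rewrite ltnS (leq_eqVlt j) => /andP[ij /orP[/eqP jk|jk]].
        by rewrite (_ : j = K) //; apply: val_inj.
      by apply: (zZ i _ iZ); rewrite ij.
  have KZ : K \notin Z by apply/negP => /Zk /=; rewrite ltnn.
  transitivity (scan M (fun v => l (subword P ++ v)) #|K |: Z| (drop k.+1 s)).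
    rewrite -(IH k.+1) //.
    - apply: eq_bigr => A AF; rewrite ksD //.
      by rewrite setUCA setUA.
    - lia.
    - by move=> i /Pk; apply: ltnW.
    - by move=> i; rewrite !inE => /orP[/eqP->//|/Zk]; apply: ltnW.
    - move=> j; rewrite ltnS leq_eqVlt => /orP[/eqP jk|jk] jw; last exact: wP.
      by move: jw; rewrite (_ : j = K) ?E //; apply: val_inj.
    - move=> i j; rewrite !inE => iZ.
      rewrite ltnS (leq_eqVlt j) => /andP[ij /orP[/eqP jk|jk]].
        by rewrite (_ : j = K) //; apply: val_inj.
      case/orP: iZ ij => [/eqP->|iZ] ij; first by move: jk; rewrite ltnNge ij.
      by apply: (zZ i _ iZ); rewrite ij.
  by rewrite cardsU1 KZ.
rewrite addrC; congr (_ + _).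
  under eq_bigr do rewrite ksD1 PKA.
  (* A selected w resets [Z] to [set0], whose cardinal is the new counter 0. *)
  rewrite (lE _ E) -(cards0 'I_(size s)) -(IH k.+1) //; first last.
  - by move=> i; rewrite inE.
  - move=> j; rewrite ltnS leq_eqVlt !inE => /orP[/eqP jk|jk] jw.
      by rewrite -val_eqE /= jk eqxx.
    by rewrite wP ?orbT.
  - by move=> i; rewrite inE.
  - lia.
  rewrite mulr_sumr; apply: eq_bigr => A AF; case: ifP; rewrite ?mulr0 // => _.
  (* A block meeting both [Z] and the later letters would have the w at [K] as an inner letter,
     since [K] already belongs to the selection. *)
  rewrite set0U psum_split; first last.
  - move=> B /subsetP BZ BZ0 BF0.
    case/set0Pn: BZ0 => i; rewrite inE => /andP[iB iZ].
    case/set0Pn: BF0 => j; rewrite !inE => /and3P[jB _ kj].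
    rewrite /block_weight ifF //; apply/negbTE/goodP => gB.
    have /BZ : K \in B by apply: (gB i K j); rewrite ?(Zk i iZ).
    rewrite !inE /= ltnn andbF orbF => /Zk /=; by rewrite ltnn.
  - rewrite -setI_eq0; apply/eqP/setP => i; rewrite !inE.
    by apply/negP => /and3P[/Zk ik _]; rewrite ltnNge ltnW.
  rewrite mulrCA; congr (_ * (_ * _)).
  rewrite (psum_good M1 ML) ?(subword_nseq Zz) //.
  apply/goodP => i j i' iZ /Zk i'k /andP[ij ji'] jw.
  by have := Z_w i j iZ (ltnW ij) jw; rewrite leqNgt (ltn_trans ji').
(* Once the w at [K] is rejected no later letter can be selected, so only [set0] survives; what
   remains is [Z] with the whole suffix, a good set. *)
rewrite (bigD1 set0) ?sub0set //= big1 ?addr0 => [|A /andP[/subsetP AF A0]].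
  rewrite setU0 cats0 ifT; last first.
    apply/w_initialP => i j jw jP /Pk ik; apply: leq_trans ik _.
    rewrite leqNgt; apply/negP => jk; by rewrite wP in jP.
  rewrite setD0 -FE (psum_good M1 ML).
    rewrite subword_cat; last by move=> i j /Zk ik; rewrite inE; apply: leq_trans.
    by rewrite (subword_nseq Zz) subword_from (drop_nth Lz) // -E (tnth_nth Lz).
  apply/goodP => i j i'; rewrite !inE => iZ _ /andP[ij _] jw.
  case/orP: iZ => [iZ|ki]; first by rewrite (Z_w i j) ?orbT // ltnW.
  by rewrite (leq_trans ki) ?orbT // ltnW.
rewrite ifF //; apply/negbTE/negP => /w_initialP wA.
have /set0Pn[i iA] := A0; have := AF i iA; rewrite inE ltnNge ltnW //.
apply: (wA i K E); last by rewrite inE iA orbT.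
by rewrite inE negb_or KP; apply: contra KF; apply: AF.
Qed.

(** With this weight a [w_initial] set that contributes must contain the first w, so the scan need
    not know where that letter is. *)
Definition w_part L : word -> C := fun v => if inSz v then 0 else L v.

(** Peel off the block of the first w: the good sets containing it are the [w_initial] ones, and
    [w_part] kills the [w_initial] sets missing it. *)
Lemma moment_scan M L s : M [::] = 1 -> admissible_cumulants M L ->
  ~~ inSz s -> M s = scan M (w_part L) 0 s.
Proof.
move=> M1 ML sw.
have /existsP[i0 i0w] : [exists i, tnth (in_tuple s) i == Lw].
  case/allPn: sw => -[] // /(tnthP (in_tuple s))[i iw] _.
  by apply/existsP; exists i; rewrite -iw.
(* [x] is the position of the first w. *)
case: (@arg_minnP _ i0 (fun i => tnth (in_tuple s) i == Lw) val i0w)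
  => x /eqP xw xmin.
have := @sum_w_initial M L (w_part L) s 0 set0 set0 M1 ML (leq0n _).
rewrite subword0 cards0 drop0 => <- //; try by move=> ?; rewrite inE.
rewrite (moment_psum _ M1 ML) (@psum_peel _ _ _ x) //.
rewrite [LHS]big_mkcond [RHS]big_mkcond; apply: eq_bigr => A _.
rewrite subsetT andbT !set0U.
have -> : [set i : 'I_(size s) | (0 <= i)%N] = setT.
  by apply/setP => i; rewrite !inE.
rewrite /block_weight /w_part.
have wA : inSz (subword A) = [forall i in A, tnth (in_tuple s) i == Lz].
  have az a : isz a = (a == Lz) by case: a.
  rewrite /inSz /subword all_map; apply/allP/forall_inP => Az i.
    by rewrite -az => iA; apply: Az; rewrite mem_enum.
  by rewrite mem_enum /= az; apply: Az.
rewrite wA; case: (boolP (x \in A)) => xA.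
  have -> : good A = w_initial A.
    apply/goodP/w_initialP => [gA i j jw jA iA|iA i j k _ kA /andP[_ jk] jw].
      have xj : (x < j)%N.
        rewrite ltn_neqAle xmin ?jw // andbT.
        by apply: contraNneq jA => /val_inj <-.
      rewrite ltn_neqAle (contraNneq _ jA) /=; last by move=> /val_inj <-.
      by rewrite leqNgt; apply: contra jA => ji; apply: (gA x j i) => //; rewrite xj.
    apply: contraT => jA; have := iA k j jw jA kA.
    by rewrite ltnNge ltnW.
  case: ifP => _; last by rewrite mul0r.
  by rewrite [in RHS]ifF //; apply/negbTE/forall_inPn; exists x; rewrite // xw.
(* If [A] misses the first w, all of [A] lies before it, where only z's occur, and [w_part]
   vanishes. *)
case: ifP => // /w_initialP iA; case: ifP => [_|/negbT]; first by rewrite mul0r.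
case/forall_inPn => i iiA iw; have := iA i x xw xA iiA.
by rewrite ltnNge xmin //; case: (tnth _ _) iw.
Qed.

(** All choices of [a] letters in a run of z's give the same subword, and the rejected ones go to
    the counter. The induction is Pascal's rule. *)
Lemma scan_nseq M l c n t :
  scan M l c (nseq n Lz ++ t) =
  \sum_(a < n.+1) 'C(n, a)%:R *
    scan M (fun v => l (nseq a Lz ++ v)) (c + (n - a)) t.
Proof.
elim: n l c => [|n IH] l c; first by rewrite big_ord1 mul1r /= addn0.
rewrite /= !IH [X in _ + X]big_ord_recl [RHS]big_ord_recl /= !subn0 !bin0 addSnnS.
rewrite addrCA; congr (_ + _).
under [RHS]eq_bigr do rewrite /bump /= add1n binS natrD mulrDl subSS.
rewrite big_split /= addrC [in RHS]big_ord_recr /= bin_small // mul0r addr0.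
congr (_ + _); apply: eq_bigr => i _; rewrite /bump /= add1n; congr (_ * scan _ _ _ _).
by rewrite addSnnS; congr (_ + _)%N; have := ltn_ord i; lia.
Qed.

End LetterScan.

(** * Cauchy products of sequences *)

Section Convolution.
Variable K : fieldType.
Implicit Types F G H : nat -> K.

Definition conv F G (n : nat) : K := \sum_(i < n.+1) F i * G (n - i)%N.

Lemma wsmul_size F G s :
  wsmul (fun s => F (size s)) (fun s => G (size s)) s = conv F G (size s).
Proof.
by apply: eq_bigr => i _; rewrite size_drop size_takel // -ltnS.
Qed.

(** A sequence is a function of the length of a word, so associativity is inherited from the product
    of word series. *)
Lemma convA F G H : conv F (conv G H) = conv (conv F G) H.
Proof.
apply/funext => n; rewrite -(size_nseq n Lz) -!wsmul_size.
have E (F1 G1 : nat -> K) : (fun s : word => conv F1 G1 (size s)) =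
    wsmul (fun s => F1 (size s)) (fun s => G1 (size s)).
  by apply/funext => s; rewrite wsmul_size.
by rewrite !E wsmulA.
Qed.

Lemma convC F G : conv F G = conv G F.
Proof.
apply/funext => n; rewrite /conv (reindex_inj rev_ord_inj) /=.
by apply: eq_bigr => i _; rewrite mulrC subSS subKn // -ltnS.
Qed.

Lemma convDl F G H : conv (fun n => F n + G n) H = (fun n => conv F H n + conv G H n).
Proof.
apply/funext => n; rewrite /conv -big_split /=.
by apply: eq_bigr => i _; rewrite mulrDl.
Qed.

Lemma conv1 F : conv F (fun n => (n == 0%N)%:R) = F.
Proof.
apply/funext => n; rewrite /conv big_ord_recr /= subnn mulr1 big1 ?add0r // => i _.
by rewrite subn_eq0 leqNgt ltn_ord mulr0.
Qed.

End Convolution.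

(** * Recursion along the runs of z *)

Section BlockSeries.
Variable K : fieldType.
Implicit Types (f g h : wseries K) (s t v : word).

(** Words are cut at every single w, runs of z being allowed to be empty; this avoids the canonical
    form of blocks. *)
Lemma word_run_ind (P : word -> Prop) :
  (forall n, P (nseq n Lz)) ->
  (forall n t, P t -> P (nseq n Lz ++ Lw :: t)) -> forall s, P s.
Proof.
move=> Pz Pw s; suff H n : P (nseq n Lz ++ s) by apply: (H 0%N).
elim: s n => [|[] s IH] n; first by rewrite cats0.
  by have := IH n.+1; rewrite -addn1 nseqD -catA.
exact/Pw/(IH 0%N).
Qed.

Lemma blocks_cat_w k bs m t : blocks (Lw :: t) = ((0%N, k) :: bs, m) ->
  forall n, blocks (nseq n Lz ++ Lw :: t) = ((n, k) :: bs, m).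
Proof. by move=> E; elim=> //= n ->. Qed.

Lemma wfact_nseq n : wfact (nseq n Lz) = n`!.
Proof. by rewrite /wfact (@of_blocksK [::] n) //= big_nil mul1n. Qed.

(** An empty run between adjacent w's contributes 0! = 1, so the factorial is multiplicative at
    every w. *)
Lemma wfact_cat_w n t : wfact (nseq n Lz ++ Lw :: t) = (n`! * wfact t)%N.
Proof.
have := @blocks_cat_w _ _ _ t.
rewrite /wfact /=; case: (blocks t) => -[|[[|a] k] bs] m /= /(_ _ _ _ erefl n) ->;
  by rewrite !big_cons /= ?fact0 ?mul1n !mulnA.
Qed.

(** The cut of the word falls either within the run before the w or after that w. *)
Lemma wsmul_cat_w f g n t :
  wsmul f g (nseq n Lz ++ Lw :: t) =
  conv (fun a => f (nseq a Lz)) (fun b => g (nseq b Lz ++ Lw :: t)) n +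
  wsmul (fun v => f (nseq n Lz ++ Lw :: v)) g t.
Proof.
elim: n f => [|n IH] f; first by rewrite wsmulS /conv big_ord1.
by rewrite /= wsmulS IH addrA; congr (_ + _); rewrite /conv [RHS]big_ord_recl.
Qed.

Lemma wsmul_nseq f g n :
  wsmul f g (nseq n Lz) =
  conv (fun a => f (nseq a Lz)) (fun b => g (nseq b Lz)) n.
Proof.
elim: n f => [|n IH] f; first by rewrite wsmul0 /conv big_ord1.
by rewrite /= wsmulS IH /conv [RHS]big_ord_recl.
Qed.

(** Linearity in this form yields additivity, scaling and passage through convolutions. *)
Lemma fstar_rec_linear (I : Type) (r : seq I) (c : I -> K) (F : I -> word -> K)
    g bs m :
  fstar_rec g bs m (fun v => \sum_(i <- r) c i * F i v) =
  \sum_(i <- r) c i * fstar_rec g bs m (F i).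
Proof.
elim: bs F => [//|[n j] bs IH F] /=.
under [RHS]eq_bigr do rewrite mulr_sumr.
rewrite exchange_big; apply: eq_bigr => a _ /=.
by rewrite IH mulr_suml; apply: eq_bigr => i _; rewrite mulrA.
Qed.

Lemma fstarD f h g t : fstar (fun v => f v + h v) g t = fstar f g t + fstar h g t.
Proof.
have := @fstar_rec_linear bool [:: true; false] (fun=> 1) (fun b => if b then f else h).
rewrite /fstar => /(_ g (blocks t).1 (blocks t).2).
rewrite big_cons big_seq1 !mul1r => <-; congr fstar_rec; apply/funext => v.
by rewrite big_cons big_seq1 !mul1r.
Qed.

Lemma fstar_conv (F : nat -> K) (H : word -> nat -> K) g n t :
  fstar (fun v => conv F (H v) n) g t =
  conv F (fun b => fstar (fun v => H v b) g t) n.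
Proof.
exact: (@fstar_rec_linear _ _ (fun i : 'I_n.+1 => F i)
  (fun (i : 'I_n.+1) v => H v (n - i)%N)).
Qed.

(** The operation is defined on maximal blocks of w's; the normalisation [g [::] = 1] lets it be
    computed one w at a time, an empty run contributing the factor 1. *)
Lemma fstar_cat_w f g n t : g [::] = 1 ->
  fstar f g (nseq n Lz ++ Lw :: t) =
  conv (fun a => fstar (fun v => f (nseq a Lz ++ Lw :: v)) g t)
       (fun b => g (nseq b Lz)) n.
Proof.
move=> g1; rewrite /conv /fstar.
(* The w in front of [t] either lengthens a block of w's that begins [t] or opens a new block, with
   [k = 0]. *)
have E : exists k bs, (forall n, blocks (nseq n Lz ++ Lw :: t)
      = ((n, k.+1) :: bs, (blocks t).2)) /\
    forall f : word -> K,
      fstar_rec g (blocks t).1 (blocks t).2 f =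
      fstar_rec g bs (blocks t).2 (fun v => f (nseq k Lw ++ v)).
  have := @blocks_cat_w _ _ _ t.
  rewrite /=; case: (blocks t) => -[|[[|a] k] bs] m /= /(_ _ _ _ erefl) E.
  - by exists 0%N, [::].
  - exists k, bs; split=> // h.
    by rewrite big_ord1 /= g1 mulr1.
  - by exists 0%N, ((a.+1, k) :: bs).
case: E => k [bs [-> E]] /=.
by apply: eq_bigr => a _; rewrite E.
Qed.

End BlockSeries.

(** * The star operation on scanned series *)

Section Star.
Variable K : fieldType.
Hypothesis pcharK : [pchar K] =i pred0.
Variables (M : word -> K) (g : wseries K).
Hypothesis g1 : g [::] = 1.
Hypothesis gV :
  conv (fun n => mgf M (nseq n Lz)) (fun n => g (nseq n Lz)) =
  fun n => (n == 0%N)%:R.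
Implicit Types (l : word -> K) (s t v : word).

(** This turns the choice of z's within a run into a Cauchy product; characteristic 0 keeps the
    binomial coefficient nonzero. *)
Lemma bin_div_fact (n a : nat) : (a <= n)%N ->
  'C(n, a)%:R / n`!%:R = (a`!%:R)^-1 * ((n - a)`!%:R)^-1 :> K.
Proof.
move=> an; rewrite -invfM -natrM -(bin_fact an) natrM invfM mulrA divff ?mul1r //.
rewrite (pcharf0P _).1 // -lt0n bin_gt0 //.
Qed.

Lemma mgf_scan_nseq l n :
  mgf (scan M l 0) (nseq n Lz) =
  conv (fun a => mgf l (nseq a Lz)) (fun b => mgf M (nseq b Lz)) n.
Proof.
rewrite /mgf -[X in scan _ _ _ X]cats0 scan_nseq mulr_suml wfact_nseq.
apply: eq_bigr => a _ /=; rewrite cats0 add0n !wfact_nseq.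
rewrite mulrAC bin_div_fact -1?ltnS //; ring.
Qed.

(** The first term selects the w after the run, the second rejects it; in both, [a] counts the
    selected z's of the run and [b] the rejected ones. *)
Lemma mgf_scan_cat_w l n t :
  mgf (scan M l 0) (nseq n Lz ++ Lw :: t) =
  conv (fun b => mgf M (nseq b Lz))
       (fun a => (a`!%:R)^-1 *
          mgf (scan M (fun v => l (nseq a Lz ++ Lw :: v)) 0) t) n +
  conv (fun a => mgf l (nseq a Lz))
       (fun b => mgf M (nseq b Lz ++ Lw :: t)) n.
Proof.
rewrite [X in X n + _]convC /mgf scan_nseq mulr_suml /conv -big_split /=.
apply: eq_bigr => a _; rewrite cats0 add0n !wfact_nseq !wfact_cat_w /=.
rewrite !(natrM _ _ (wfact t)) !invfM [LHS]mulrACA bin_div_fact -1?ltnS //; ring.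
Qed.

(* This is proved for all weights [l] at once because the induction
   on the word replaces [l] by its left quotients [l (z^a w _)]. *)
Lemma fstar_mgf_scan l :
  fstar (mgf (scan M l 0)) g = wsmul (mgf l) (fstar (mgf M) g).
Proof.
apply/funext => t; elim/word_run_ind: t l => [n|n t IH] l.
  rewrite fstar_z mgf_scan_nseq wsmul_nseq; congr conv.
  by apply/funext => b; rewrite fstar_z.
rewrite fstar_cat_w // wsmul_cat_w.
(* [H] gathers the contributions that select this w, [N] those that reject it. *)
pose H a := wsmul (fun v => mgf l (nseq a Lz ++ Lw :: v)) (fstar (mgf M) g) t.
pose N b := fstar (fun v => mgf M (nseq b Lz ++ Lw :: v)) g t.
transitivity (conv (fun a => conv (fun b => mgf M (nseq b Lz)) H a +
    conv (fun a => mgf l (nseq a Lz)) N a) (fun b => g (nseq b Lz)) n).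
  congr (conv _ _ n); apply/funext => a.
  under [X in fstar X]funext do rewrite mgf_scan_cat_w.
  rewrite fstarD !fstar_conv; congr (conv _ _ a + _); apply/funext => b.
  have -> : H b = (b`!%:R)^-1 *
      wsmul (mgf (fun v => l (nseq b Lz ++ Lw :: v))) (fstar (mgf M) g) t.
    rewrite -wsmulZl; congr (wsmul _ _ t); apply/funext => v.
    by rewrite /mgf wfact_cat_w natrM invfM mulrCA.
  rewrite -IH /fstar.
  have := @fstar_rec_linear K unit [:: tt] (fun=> (b`!%:R)^-1)
    (fun=> mgf (scan M (fun v => l (nseq b Lz ++ Lw :: v)) 0)) g.
  move=> /(_ (blocks t).1 (blocks t).2); rewrite big_seq1 => <-.
  by congr fstar_rec; apply/funext => v; rewrite big_seq1.
rewrite convDl addrC; congr (_ + _).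
  rewrite -convA; congr (conv _ _ n); apply/funext => b.
  by rewrite fstar_cat_w.
(* The moments of the rejected z's meet the factor [g] of the same run and cancel, leaving [H]. *)
by rewrite [X in conv X]convC -convA gV conv1.
Qed.

End Star.

(** * The identity in the algebra of word series *)

Theorem cumulant_series (K : fieldType) (M L : word -> K) :
  [pchar K] =i pred0 -> M [::] = 1 -> admissible_cumulants M L ->
  let Mz := restr_z (mgf M) in
  let Mstar := fstar (mgf M) Mz^-1 in
  cgf L = restr_z (cgf L) + (Mstar - Mz) * Mstar^-1.
Proof.
move=> K0 M1 ML Mz Mstar.
have M1' : mgf M [::] = 1 by rewrite /mgf M1 (wfact_nseq 0) divr1.
have Mz1 : Mz [::] = 1 by rewrite /Mz /restr_z M1'.
have uM : Mz \is a GRing.unit by rewrite wseries_unitE Mz1 oner_neq0.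
have zz n : inSz (nseq n Lz) by rewrite /inSz all_nseq orbT.
have zw n t : inSz (nseq n Lz ++ Lw :: t) = false by rewrite /inSz all_cat andbF.
have g1 : Mz^-1 [::] = 1.
  by rewrite [Mz^-1]/GRing.inv /= ws_inv0 ?Mz1 ?invr1 // /ws_unit Mz1 oner_neq0.
have gV : conv (fun n => mgf M (nseq n Lz)) (fun n => Mz^-1 (nseq n Lz)) =
    fun n => (n == 0%N)%:R.
  apply/funext => n.
  have E : wsmul Mz Mz^-1 (nseq n Lz) = ws1 K (nseq n Lz).
    by rewrite -[wsmul _ _]/(Mz * Mz^-1) mulrV.
  transitivity (ws1 K (nseq n Lz)); last by case: n {E}.
  rewrite -E wsmul_nseq; congr (conv _ _ n); apply/funext => a.
  by rewrite /Mz /restr_z zz.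
have uMstar : Mstar \is a GRing.unit.
  by rewrite wseries_unitE /Mstar (fstar_z _ _ 0) M1' oner_neq0.
have E : Mstar - Mz = (cgf L - restr_z (cgf L)) * Mstar.
  (* At the empty word [cgf] is 0 by convention, and [w_part] is 0 because that word lies in
     S(z). *)
  have -> : cgf L - restr_z (cgf L) = mgf (w_part L).
    apply/funext => s; rewrite [LHS]/GRing.add /= [X in _ + X]/GRing.opp /=.
    rewrite /restr_z /mgf /w_part; case: ifP; rewrite ?subrr ?mul0r // subr0.
    by case: s.
  rewrite [RHS]/GRing.mul /= -(fstar_mgf_scan K0 g1 gV).
  apply/funext => s; rewrite [LHS]/GRing.add /= [X in _ + X]/GRing.opp /=.
  elim/word_run_ind: s => [n|n t _].
    (* On powers of z both sides vanish, the right one because [w_part] does. *)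
    rewrite /Mstar !fstar_z /Mz /restr_z zz subrr mgf_scan_nseq // /conv big1 // => i _.
    by rewrite /mgf /w_part zz !mul0r.
  (* On a word containing w, the star operation evaluates its argument only at words containing w,
     where [moment_scan] applies. *)
  rewrite {1}/Mz /restr_z zw subr0 /Mstar !fstar_cat_w //.
  congr (conv _ _ n); apply/funext => a; congr (fstar _ _ t); apply/funext => v.
  by rewrite /mgf -(moment_scan M1 ML) ?zw.
by rewrite E mulrK // addrCA subrr addr0.
Qed.

Theorem corollary7p4 (R : realType) (phi : {scalar calB R})
    (hphi : is_state phi)
    (L : word -> R[i]) (hL : admissible_cumulants (moment phi) L) :
  let Mzw : wseries R[i] := mgf (moment phi) in
  let Lzw : wseries R[i] := cgf L in
  let Mz0 := restr_z Mzw in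
  let Lz0 := restr_z Lzw in
  let Mstar := fstar Mzw Mz0^-1 in
  Lzw = Lz0 + (Mstar - Mz0) * Mstar^-1.
Proof.
(* The field [R[i]] has characteristic 0, and the moment of the empty word is [phi 1], which is 1
   for a state. *)
apply: cumulant_series hL; first exact: Num.Theory.pchar_num.
by case: hphi => + _; rewrite /moment big_nil.
Qed.
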